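(* Consider the D1Q3 lattice Boltzmann scheme for one conserved scalar, with the orthogonalized moments $m_0=f_0+f_1+f_2$, $m_1=\lambda(f_1-f_2)$, $m_2=\lambda^2(-2f_0+f_1+f_2)$, with equilibrium values $m_1^{eq}=0$, $m_2^{eq}=\lambda^2\tilde\zeta\rho$ (where $2+\tilde\zeta>0$), with relaxation rates $s_1,s_2\in(0,2)$, and with a uniform source, as described in the context. Put $\sigma_\ell=\frac1{s_\ell}-\frac12$ for $\ell=1,2$. Then the ''anti bounce-back'' numerical boundary condition $$f_1(x_b,t+\Delta t)=-f_2^{*}(x_b,t)$$ at the fluid node $x_b$ adjacent to the left boundary is of order $3$ at location $\Delta q=\frac{\Delta x}{2}$ (in the sense of the context) for the homogeneous Dirichlet boundary condition of the Poisson problem $-K\rho''=c$ on $]0,1[$, $\rho(0)=\rho(1)=0$, if and only if $$\sigma_1\,\sigma_2=\frac38 .$$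
   Context: Scaling: $\Delta x>0$ is the space step, $\Delta t>0$ the time step, and $\lambda=\Delta x/\Delta t$ is a fixed reference velocity. All $\mathrm O(\cdot)$ are for $\Delta x\to0$ with $\lambda,\tilde\zeta,s_1,s_2$ fixed. Scheme (D1Q3). The velocities are $v_0=0$, $v_1=\lambda$, $v_2=-\lambda$. The unknowns are three functions $f_0,f_1,f_2$ of $(x,t)$. Write $f=(f_0,f_1,f_2)^T$, $m=Mf$ with $$M=\begin{pmatrix}1&1&1\\0&\lambda&-\lambda\\-2\lambda^2&\lambda^2&\lambda^2\end{pmatrix}.$$ Let $\delta p$ be a source, constant in $x$ and $t$, which may depend on $\Delta x$. One time step consists of the following operations at each point. 1. Compute $m=Mf$. 2. Set $\rho:=m_0+\frac12\delta p$ (the density of the scheme). 3. Relax the non-conserved moments: $m_\ell^*=(1-s_\ell)m_\ell+s_\ell m_\ell^{eq}$ for $\ell=1,2$, where the equilibrium values are computed with this $\rho$. 4. Add the second half of the source: $m_0^*=\rho+\frac12\delta p$. 5. Set $f^*=M^{-1}m^*$. 6. Advect: $f_j(x,t+\Delta t)=f_j^*(x-v_j\Delta t,t)$, $j=0,1,2$. The scheme models the Poisson problem with $K=\kappa=\Delta t\,\lambda^2\sigma_1\frac{2+\tilde\zeta}{3}$ and $c=\delta p/\Delta t$. Boundary. $x_b$ is the fluid node adjacent to the left boundary and $x_e=x_b-\Delta x$ is a fictitious exterior node. The discrete fields are regarded as smooth functions extended slightly beyond the boundary, so that advection from the exterior node reads $f_1(x_b,t+\Delta t)=f_1^*(x_e,t)$.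 The anti bounce-back condition thus amounts to $f_1^*(x_e,t)+f_2^*(x_b,t)=0$. Order of a boundary scheme. The fields are assumed to be steady (independent of $t$) and slowly varying. That is, for each small $\Delta x$, the functions $f_j=f_j^{\Delta x}$ are $C^\infty$ on a fixed open interval $I\ni x_b$, with derivatives of every order bounded on $I$ uniformly in $\Delta x$, and, for some constant $\delta p=\delta p(\Delta x)$, they satisfy $f_j(x)=f_j^*(x-v_j\Delta t)$ for $j=0,1,2$ whenever $x$ and $x-v_j\Delta t$ lie in $I$, where $f^*=M^{-1}m^*$ with $m=Mf$, $\rho=m_0+\frac12\delta p$, $m_0^*=\rho+\frac12\delta p$, $m_1^*=(1-s_1)m_1$ and $m_2^*=(1-s_2)m_2+s_2\lambda^2\tilde\zeta\rho$. The boundary scheme is said to be of order $p$ at location $\Delta q$ for the homogeneous Dirichlet condition if, for every such family which in addition satisfies the numerical boundary condition at $x_b$, one has $\rho(x_b-\Delta q)=\mathrm O(\Delta x^p)$. *)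

(* Defs.v *)
From HB Require Import structures.
From mathcomp Require Import all_boot all_order all_algebra.
From mathcomp Require Import all_classical all_reals all_analysis.

Set Implicit Arguments.
Unset Strict Implicit.
Unset Printing Implicit Defensive.

Import Order.TTheory GRing.Theory Num.Theory.
Import numFieldNormedType.Exports.

Local Open Scope classical_set_scope.
Local Open Scope ring_scope.

Definition velocity (R : realType) (lambda : R) (j : 'I_3) : R :=
  [:: 0; lambda; - lambda]`_j.

Definition moment_mx (R : realType) (lambda : R) : 'M[R]_3 :=
  \matrix_(i < 3, j < 3)
    (nth [::] [:: [:: 1; 1; 1];
                  [:: 0; lambda; - lambda];
                  [:: - 2 * lambda ^+ 2; lambda ^+ 2; lambda ^+ 2]] i)`_j.

Definition time_step (R : realType) (lambda dx : R) : R := dx / lambda.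

(* The density contains the first half of the source. *)
Definition density (R : realType) (lambda dp : R) (f : 'cV[R]_3) : R :=
  (moment_mx lambda *m f) 0 0 + dp / 2.

Definition relax (R : realType) (s m meq : R) : R := (1 - s) * m + s * meq.

(* m^* : the equilibria of m_1 and m_2 are 0 and lambda^2 zeta rho, and the
   second half of the source is added to the conserved moment. *)
Definition moments_star (R : realType) (lambda zeta s1 s2 dp : R)
    (f : 'cV[R]_3) : 'cV[R]_3 :=
  let m := moment_mx lambda *m f in
  let rho := density lambda dp f in
  \col_(l < 3) [:: rho + dp / 2;
                   relax s1 (m 1 0) 0;
                   relax s2 (m 2 0) (lambda ^+ 2 * zeta * rho)]`_l.

Definition f_star (R : realType) (lambda zeta s1 s2 dp : R)
    (f : 'cV[R]_3) : 'cV[R]_3 :=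
  invmx (moment_mx lambda) *m moments_star lambda zeta s1 s2 dp f.

(* One full time step (collision, source, advection) for a space-time field
   F x t, wherever both ends of the advection lie in A. *)
Definition lb_scheme (R : realType) (lambda zeta s1 s2 : R) (A : set R)
    (dx dp : R) (F : R -> R -> 'cV[R]_3) : Prop :=
  let dt := time_step lambda dx in
  forall (j : 'I_3) (x t : R), A x -> A (x - velocity lambda j * dt) ->
    F x (t + dt) j 0 =
    f_star lambda zeta s1 s2 dp (F (x - velocity lambda j * dt) t) j 0.

Definition anti_bounce_back (R : realType) (lambda zeta s1 s2 xb : R)
    (dx dp : R) (F : R -> R -> 'cV[R]_3) : Prop :=
  let dt := time_step lambda dx in
  forall t : R, F xb (t + dt) 1 0 = - f_star lambda zeta s1 s2 dp (F xb t) 2 0.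

Definition steady (R : realType) (f : R -> 'cV[R]_3) : R -> R -> 'cV[R]_3 :=
  fun x _ => f x.

Definition smooth_on (R : realType) (A : set R) (g : R -> R) : Prop :=
  forall (k : nat) (x : R), A x -> derivable (derive1n k g) x 1.

(* Steady, slowly varying families f dx (0 < dx < dx0) of solutions of the
   scheme on A; the bound C may depend on the order k but not on dx. *)
Definition slow_steady_family (R : realType) (lambda zeta s1 s2 : R)
    (A : set R) (dx0 : R) (dp : R -> R) (f : R -> R -> 'cV[R]_3) : Prop :=
  [/\ forall (dx : R) (j : 'I_3), 0 < dx < dx0 ->
        smooth_on A (fun x => f dx x j 0),
      forall (k : nat) (j : 'I_3), exists C : R, forall dx x : R,
        0 < dx < dx0 -> A x -> `|derive1n k (fun y => f dx y j 0) x| <= C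
    & forall dx : R, 0 < dx < dx0 ->
        lb_scheme lambda zeta s1 s2 A dx (dp dx) (steady (f dx))].

(* The boundary scheme bc at the node xb is of order p at location dq for the
   homogeneous Dirichlet condition; bc dx dp F is the numerical boundary
   condition on the space-time field F. *)
Definition dirichlet_order (R : realType) (lambda zeta s1 s2 xb : R)
    (bc : R -> R -> (R -> R -> 'cV[R]_3) -> Prop) (dq : R -> R) (p : nat)
    : Prop :=
  forall (A : set R) (dx0 : R) (dp : R -> R) (f : R -> R -> 'cV[R]_3),
    open A -> is_interval A -> A xb -> 0 < dx0 ->
    slow_steady_family lambda zeta s1 s2 A dx0 dp f ->
    (forall dx : R, 0 < dx < dx0 -> bc dx (dp dx) (steady (f dx))) ->
    (fun dx : R => density lambda (dp dx) (f dx (xb - dq dx)))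
      =O_ ((0 : R)^'+) (fun dx : R => dx ^+ p).

Definition sigma (R : realType) (s : R) : R := 1 / s - 1 / 2.

(* Main.v *)
Require Import Defs.
From mathcomp Require Import all_boot all_order all_algebra ring lra.
From mathcomp Require Import all_classical all_reals all_analysis.

Import Order.TTheory GRing.Theory Num.Theory.
Import numFieldNormedType.Exports.
Local Open Scope ring_scope.

(** Let [d] be the source. The equation for the rest population determines
    [f_0] pointwise and makes [(2 + zeta) * rho] affine in [f_1 + f_2]. The two
    advection equations then fix [f_1] and [f_2] on the lattice [xb - n * dx] in
    terms of [f_1 xb], [f_2 xb] and [d], where [f_1 + f_2] agrees with a
    quadratic polynomial in [n]. Under anti bounce-back the value of that
    quadratic at [n = 1/2] gives the density
    [d * (sigma1 * sigma2 - 3/8) / (sigma1 * (2 + zeta))].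
    If [sigma1 * sigma2 = 3/8], interpolation at [xb, xb - dx, xb - 2 * dx] has
    error [O(dx ^+ 3)] because the third derivatives are bounded. Conversely,
    there is an exact solution, quadratic in [x], with [d = dx ^+ 2]; its density
    at [xb - dx / 2] is given exactly by the formula above. *)

(** * The collision operator in closed form *)

Lemma sum_ord3 (R : realType) (F : 'I_3 -> R) :
  \sum_(i < 3) F i = F 0 + F 1 + F 2.
Proof.
rewrite !big_ord_recl big_ord0 addr0 addrA.
by congr (_ + F _ + F _); exact/val_inj.
Qed.

Lemma densityE (R : realType) (lambda dp : R) (f : 'cV[R]_3) :
  density lambda dp f = f 0 0 + f 1 0 + f 2 0 + dp / 2.
Proof. by rewrite /density mxE sum_ord3 !mxE /= !mul1r. Qed.

Definition invmoment_mx {R : realType} (lambda : R) : 'M[R]_3 :=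
  \matrix_(i < 3, j < 3)
    (nth [::] [:: [:: 3^-1; 0; - (3 * lambda ^+ 2)^-1];
                  [:: 3^-1; (2 * lambda)^-1; (6 * lambda ^+ 2)^-1];
                  [:: 3^-1; - (2 * lambda)^-1; (6 * lambda ^+ 2)^-1]] i)`_j.

Lemma invmx_moment_mx (R : realType) (lambda : R) : lambda != 0 ->
  invmx (moment_mx lambda) = invmoment_mx lambda.
Proof.
move=> l0; have MN : moment_mx lambda *m invmoment_mx lambda = 1%:M.
  apply/matrixP => i j; rewrite mxE sum_ord3 !mxE.
  by case: i => -[|[|[|//]]] ?; case: j => -[|[|[|//]]] ? /=;
    rewrite /eq_op /=; field.
have [Mu _] := mulmx1_unit MN.
by rewrite -[LHS]mulmx1 -MN mulKmx.
Qed.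

Section PostCollision.
Variables (R : realType) (lambda zeta s1 s2 dp : R) (f : 'cV[R]_3).
Hypothesis lambda_neq0 : lambda != 0.

(** These are the moments [m_0], [m_1 / lambda] and [m_2 / lambda ^+ 2]; in these units [lambda]
    cancels from the post-collision populations. *)
Let u := f 0 0 + f 1 0 + f 2 0.
Let q := f 1 0 - f 2 0.
Let e := f 1 0 + f 2 0 - 2 * f 0 0.
Let e_star := (1 - s2) * e + s2 * zeta * (u + dp / 2).

Lemma f_star0E :
  f_star lambda zeta s1 s2 dp f 0 0 = (u + dp - e_star) / 3.
Proof.
rewrite /f_star invmx_moment_mx// mxE sum_ord3 !mxE /= /relax densityE.
by rewrite ?mxE ?sum_ord3 ?mxE /= /e_star /e /u; field.
Qed.

Lemma f_star1E : f_star lambda zeta s1 s2 dp f 1 0 =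
  (u + dp) / 3 + (1 - s1) * q / 2 + e_star / 6.
Proof.
rewrite /f_star invmx_moment_mx// mxE sum_ord3 !mxE /= /relax densityE.
by rewrite ?mxE ?sum_ord3 ?mxE /= /e_star /e /u /q; field.
Qed.

Lemma f_star2E : f_star lambda zeta s1 s2 dp f 2 0 =
  (u + dp) / 3 - (1 - s1) * q / 2 + e_star / 6.
Proof.
rewrite /f_star invmx_moment_mx// mxE sum_ord3 !mxE /= /relax densityE.
by rewrite ?mxE ?sum_ord3 ?mxE /= /e_star /e /u /q; field.
Qed.

End PostCollision.

(** * The steady rest equation and the two-velocity recursion *)

Section RestState.
Variables (R : realType) (lambda zeta s1 s2 dp : R) (f : 'cV[R]_3).
Hypothesis lambda_neq0 : lambda != 0.
Hypothesis s2_neq0 : s2 != 0.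
Hypothesis rest : f 0 0 = f_star lambda zeta s1 s2 dp f 0 0.

(** The rest equation says [e_star = u + dp - 3 * f_0]. Substituting this removes [f_0], [zeta] and
    [s2], so the moving populations obey a closed recursion governed by [s1] alone. *)
Lemma rest_f_star1 : f_star lambda zeta s1 s2 dp f 1 0 =
  (f 1 0 + f 2 0 + dp) / 2 + (1 - s1) * (f 1 0 - f 2 0) / 2.
Proof. by move: rest; rewrite f_star0E// f_star1E//; lra. Qed.

Lemma rest_f_star2 : f_star lambda zeta s1 s2 dp f 2 0 =
  (f 1 0 + f 2 0 + dp) / 2 - (1 - s1) * (f 1 0 - f 2 0) / 2.
Proof. by move: rest; rewrite f_star0E// f_star2E//; lra. Qed.

(** With [e = u - 3 * f_0] the rest equation becomes [e_star = e + dp], that is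
    [zeta * rho = e + dp / s2]; adding [2 * rho = 2 * u + dp] eliminates [f_0]. *)
Lemma rest_density : (2 + zeta) * density lambda dp f =
  3 * (f 1 0 + f 2 0) + 3 * dp / 2 + dp * sigma s2.
Proof.
move: rest; rewrite f_star0E// densityE /sigma => H.
apply: (mulfI s2_neq0).
transitivity (s2 * (3 * (f 1 0 + f 2 0) + dp) + dp); last by field.
by lra.
Qed.

End RestState.

(** Here [b] and [c] stand for [f_1] and [f_2], with index [n] for the node [xb - n * dx]. The
    weights 3, 6, -1, divided by 8, are the Lagrange weights at [n = 1/2] for the nodes 0, 1, 2. The
    condition reads [b0 = - c1] because in a steady state [f_2] at [xb - dx] is the post-collision
    [f_2] at [xb]. *)
Lemma lattice_extrapolation (R : realType) (s1 d b0 c0 b1 c1 b2 c2 : R) :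
  s1 != 0 -> 2 - s1 != 0 ->
  b0 = (b1 + c1 + d) / 2 + (1 - s1) * (b1 - c1) / 2 ->
  b1 = (b2 + c2 + d) / 2 + (1 - s1) * (b2 - c2) / 2 ->
  c1 = (b0 + c0 + d) / 2 - (1 - s1) * (b0 - c0) / 2 ->
  c2 = (b1 + c1 + d) / 2 - (1 - s1) * (b1 - c1) / 2 ->
  b0 = - c1 ->
  3 * (b0 + c0) + 6 * (b1 + c1) - (b2 + c2) + 4 * d = - d / sigma s1.
Proof.
move=> s10 s12 E1 E2 E3 E4 BC.
(* All values are expressed through [b0] and [d]; [b0] cancels in the final combination. *)
have e1 : c1 = - b0 by rewrite BC opprK.
rewrite {}e1 in E1 E3 E4 *.
have e2 : b1 = ((2 + s1) * b0 - d) / (2 - s1).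
  by apply: (mulIf s12); rewrite divfK//; lra.
have e3 : c0 = (- (2 + s1) * b0 - d) / (2 - s1).
  by apply: (mulIf s12); rewrite divfK//; lra.
have e4 : c2 = b1 - 2 * b0 + d by lra.
have e5 : b2 = (2 * b1 - s1 * c2 - d) / (2 - s1).
  by apply: (mulIf s12); rewrite divfK//; lra.
have -> : sigma s1 = (2 - s1) / (2 * s1) by rewrite /sigma; field.
rewrite e5 e4 e3 e2; field.
by rewrite s12 s10.
Qed.

(** * Taylor remainders and quadratic interpolation *)

Lemma norm_le_derive {R : realType} (G dG : R -> R) (x y C : R) (n : nat) :
  0 <= C -> y <= x -> G x = 0 ->
  (forall t, y <= t <= x -> is_derive t 1 G (dG t)) ->
  (forall t, y <= t <= x -> `|dG t| <= C * (x - t) ^+ n) ->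
  `|G y| <= C * (x - y) ^+ n.+1.
Proof.
move=> C0 yx Gx GdG dGC.
have [t| |c] := @MVT_segment R G dG y x yx.
- by rewrite in_itv /= => /andP[? ?]; apply: GdG; rewrite !ltW.
- apply: derivable_within_continuous => t; rewrite in_itv /= => tyx.
  by have [] := GdG t tyx.
rewrite in_itv /= => cyx; rewrite Gx sub0r => /(congr1 Num.norm).
have xy0 : 0 <= x - y by rewrite subr_ge0.
have /andP[yc cx] := cyx.
rewrite normrN normrM (ger0_norm xy0) => ->.
rewrite exprSr mulrA ler_wpM2r//; apply: (le_trans (dGC c cyx)).
by rewrite ler_wpM2l// lerXn2r ?nnegrE ?subr_ge0// lerD2l lerN2.
Qed.

(** The bound on the third derivative is integrated three times by [norm_le_derive]. Each use of the
    mean value theorem gains a power of [x - y] but no factorial, hence [C] rather than [C / 6]. *)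
Lemma taylor2_le {R : realType} (g : R -> R) (x y C : R) :
  0 <= C -> y <= x ->
  (forall k t, y <= t <= x -> derivable (derive1n k g) t 1) ->
  (forall t, y <= t <= x -> `|derive1n 3 g t| <= C) ->
  `|g y - (g x + derive1n 1 g x * (y - x) + derive1n 2 g x * (y - x) ^+ 2 / 2)|
    <= C * (x - y) ^+ 3.
Proof.
move=> C0 yx dg g3.
have D k t : y <= t <= x -> is_derive t 1 (derive1n k g) (derive1n k.+1 g t).
  move=> tyx; rewrite derive1nS derive1E; apply: derivableP; exact: dg.
have sub t u : y <= t <= x -> t <= u <= x -> y <= u <= x.
  by move=> /andP[yt _] /andP[tu ->]; rewrite (le_trans yt tu).
have g2 t : y <= t <= x ->
    `|derive1n 2 g t - derive1n 2 g x| <= C * (x - t) ^+ 1.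
  move=> tyx; have /andP[_ tx] := tyx.
  apply: (@norm_le_derive _ (fun t => derive1n 2 g t - derive1n 2 g x)
    (derive1n 3 g)) => //; first by rewrite subrr.
  + move=> u /(sub _ _ tyx) uyx; have := D 2%N u uyx => ?.
    by apply: is_derive_eq; rewrite subr0.
  + by move=> u /(sub _ _ tyx) uyx; rewrite expr0 mulr1 g3.
have g1 t : y <= t <= x ->
    `|derive1n 1 g t - (derive1n 1 g x + derive1n 2 g x * (t - x))|
      <= C * (x - t) ^+ 2.
  move=> tyx; have /andP[_ tx] := tyx.
  apply: (@norm_le_derive _
    (fun t => derive1n 1 g t - (derive1n 1 g x + derive1n 2 g x * (t - x)))
    (fun t => derive1n 2 g t - derive1n 2 g x)) => //.
  + by rewrite subrr mulr0 addr0 subrr.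
  + move=> u /(sub _ _ tyx) uyx; have := D 1%N u uyx => ?.
    apply: is_derive_eq.
    rewrite /GRing.scale /=.
    by rewrite add0r mul1r subr0 mulr1.
  + by move=> u /(sub _ _ tyx) uyx; exact: g2.
have yyx : y <= y <= x by rewrite lexx.
apply: (@norm_le_derive _
    (fun t => g t - (g x + derive1n 1 g x * (t - x)
                     + derive1n 2 g x * (t - x) ^+ 2 / 2))
    (fun t => derive1n 1 g t - (derive1n 1 g x + derive1n 2 g x * (t - x))))
  => //.
- by rewrite subrr mulr0 addr0 expr0n /= mulr0 mul0r addr0 subrr.
- move=> u uyx; have := D 0%N u uyx; rewrite derive1n0 => ?.
  apply: is_derive_eq.
  rewrite /GRing.scale /=.
  by move: (derive1n 1 g u) (derive1n 1 g x) (derive1n 2 g x) => *; field.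
Qed.

(** The weights are exact on quadratics, so only Taylor remainders survive:
    [1/8 + 6/8 + 8/8 = 15/8 <= 2] times [C * h ^+ 3]. *)
Lemma midpoint_interpolation_le {R : realType} (g : R -> R) (x h C : R) :
  0 <= C -> 0 <= h ->
  (forall k t, x - 2 * h <= t <= x -> derivable (derive1n k g) t 1) ->
  (forall t, x - 2 * h <= t <= x -> `|derive1n 3 g t| <= C) ->
  `|g (x - h / 2) - (3 * g x + 6 * g (x - h) - g (x - 2 * h)) / 8|
    <= 2 * C * h ^+ 3.
Proof.
move=> C0 h0 dg g3.
have T y : x - 2 * h <= y -> y <= x -> _ :=
  fun ay yx => @taylor2_le R g x y C C0 yx
    (fun k t tyx => dg k t ltac:(lra)) (fun t tyx => g3 t ltac:(lra)).
have := T (x - h / 2) ltac:(lra) ltac:(lra).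
have := T (x - h) ltac:(lra) ltac:(lra).
have := T (x - 2 * h) ltac:(lra) ltac:(lra).
set g0 := g x; set g1 := derive1n 1 g x; set g2 := derive1n 2 g x.
have -> : x - (x - 2 * h) = 2 * h by ring.
have -> : x - (x - h) = h by ring.
have -> : x - (x - h / 2) = h / 2 by ring.
have -> : x - 2 * h - x = - (2 * h) by ring.
have -> : x - h - x = - h by ring.
have -> : x - h / 2 - x = - (h / 2) by ring.
rewrite !exprMn !sqrrN !ler_norml.
have : 0 <= C * h ^+ 3 by rewrite mulr_ge0 ?exprn_ge0.
move: (h ^+ 3) => H.
rewrite !exprMn. lra.
Qed.

(** * The scheme as three steady equations with shifts by one cell *)

Lemma lb_scheme_steady {R : realType} (lambda zeta s1 s2 dx dp : R) (A : set R)
    (f : R -> 'cV[R]_3) : lambda != 0 ->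
  lb_scheme lambda zeta s1 s2 A dx dp (steady f) <->
  [/\ forall x, A x -> f x 0 0 = f_star lambda zeta s1 s2 dp (f x) 0 0,
      forall x, A x -> A (x - dx) ->
        f x 1 0 = f_star lambda zeta s1 s2 dp (f (x - dx)) 1 0
    & forall x, A x -> A (x + dx) ->
        f x 2 0 = f_star lambda zeta s1 s2 dp (f (x + dx)) 2 0].
Proof.
move=> l0; rewrite /lb_scheme /steady /time_step.
have ldx : lambda * (dx / lambda) = dx by rewrite mulrC divfK.
have v0 x : x - velocity lambda 0 * (dx / lambda) = x.
  by rewrite /velocity /= mul0r subr0.
have v1 x : x - velocity lambda 1 * (dx / lambda) = x - dx.
  by rewrite /velocity /= ldx.
have v2 x : x - velocity lambda 2 * (dx / lambda) = x + dx.
  by rewrite /velocity /= mulNr ldx opprK.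
split=> [H|[H0 H1 H2]].
  by split=> x Ax => [|Ax'|Ax'];
    [have := H 0 x 0 | have := H 1 x 0 | have := H 2 x 0];
    rewrite ?v0 ?v1 ?v2; apply.
move=> j x _; have : (j == 0) || (j == 1) || (j == 2).
  by case: j => -[|[|[|//]]].
by move=> /orP[/orP[]|] /eqP->; rewrite ?v0 ?v1 ?v2; auto.
Qed.

(** * Sufficiency of the relation between the relaxation rates *)

Section Sufficiency.
Variables (R : realType) (lambda zeta s1 s2 xb : R).
Hypotheses (lambda_gt0 : 0 < lambda) (zeta_gt : 0 < 2 + zeta).
Hypotheses (s1_bound : 0 < s1 < 2) (s2_gt0 : 0 < s2).
Hypothesis sigmaE : sigma s1 * sigma s2 = 3 / 8.

(** By [rest_density] and [lattice_extrapolation], the combination times [2 + zeta] is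
    [8 * dp * sigma s2 - 3 * dp / sigma s1], which vanishes by [sigmaE]. *)
Lemma density_interpolation (A : set R) (dx dp : R) (f : R -> 'cV[R]_3) :
  A xb -> A (xb - dx) -> A (xb - 2 * dx) ->
  lb_scheme lambda zeta s1 s2 A dx dp (steady f) ->
  anti_bounce_back lambda zeta s1 s2 xb dx dp (steady f) ->
  3 * density lambda dp (f xb) + 6 * density lambda dp (f (xb - dx))
    = density lambda dp (f (xb - 2 * dx)).
Proof.
move=> A0 A1 A2 /(lb_scheme_steady _ _ _ _ _ _ _ _ (lt0r_neq0 lambda_gt0)).
move=> [H0 H1 H2] /(_ 0); rewrite /steady => BC.
have l0 := lt0r_neq0 lambda_gt0; have s20 := lt0r_neq0 s2_gt0.
have s10 : s1 != 0 by apply: lt0r_neq0; case/andP: s1_bound.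
have s12 : 2 - s1 != 0.
  by apply: lt0r_neq0; case/andP: s1_bound; rewrite subr_gt0.
have e1 : xb - 2 * dx + dx = xb - dx by ring.
have e2 : xb - dx - dx = xb - 2 * dx by ring.
have E1 := H1 xb A0 A1.
have := H1 (xb - dx) A1; rewrite e2 => /(_ A2) E2.
have := H2 (xb - dx) A1; rewrite subrK => /(_ A0) E3.
have := H2 (xb - 2 * dx) A2; rewrite e1 => /(_ A1) E4.
rewrite -E3 in BC.
rewrite (rest_f_star1 _ _ _ _ _ _ _ l0 (H0 _ A1)) in E1.
rewrite (rest_f_star1 _ _ _ _ _ _ _ l0 (H0 _ A2)) in E2.
rewrite (rest_f_star2 _ _ _ _ _ _ _ l0 (H0 _ A0)) in E3.
rewrite (rest_f_star2 _ _ _ _ _ _ _ l0 (H0 _ A1)) in E4.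
have X := lattice_extrapolation _ _ _ _ _ _ _ _ _ s10 s12 E1 E2 E3 E4 BC.
have D0 := rest_density _ _ _ _ _ _ _ l0 s20 (H0 _ A0).
have D1 := rest_density _ _ _ _ _ _ _ l0 s20 (H0 _ A1).
have D2 := rest_density _ _ _ _ _ _ _ l0 s20 (H0 _ A2).
apply: (mulfI (lt0r_neq0 zeta_gt)); rewrite mulrDr.
rewrite [_ * (3 * _)]mulrCA [_ * (6 * _)]mulrCA D0 D1 D2.
have sg : sigma s1 != 0.
  by apply/eqP => s0; move: sigmaE; rewrite s0 mul0r; lra.
have : dp / sigma s1 = 8 / 3 * (dp * sigma s2).
  apply: (mulIf sg); rewrite divfK//.
  transitivity (8 / 3 * dp * (sigma s1 * sigma s2)); last by ring.
  by rewrite sigmaE; field.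
move: X; rewrite mulNr; lra.
Qed.

(** The quadratic interpolant of the density vanishes at [xb - dx / 2], so the density there is pure
    interpolation error. *)
Lemma anti_bounce_back_order3 :
  dirichlet_order lambda zeta s1 s2 xb
    (anti_bounce_back lambda zeta s1 s2 xb) (fun dx : R => dx / 2) 3.
Proof.
move=> A dx0 dp f oA iA Axb dx0_gt0 [fsm fbd fsch] fbc.
have l0 := lt0r_neq0 lambda_gt0.
have [C C0 fC] : exists2 C, 0 <= C &
    forall (j : 'I_3) dx x, 0 < dx < dx0 -> A x ->
    `|derive1n 3 (fun y => f dx y j 0) x| <= C.
  have [C0 H0] := fbd 3%N 0; have [C1 H1] := fbd 3%N 1.
  have [C2 H2] := fbd 3%N 2.
  exists (`|C0| + `|C1| + `|C2|); first by rewrite !addr_ge0.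
  move=> j dx x hdx Ax; have : (j == 0) || (j == 1) || (j == 2).
    by case: j => -[|[|[|//]]].
  have := ler_norm C0; have := ler_norm C1; have := ler_norm C2.
  have := normr_ge0 C0; have := normr_ge0 C1; have := normr_ge0 C2.
  by move=> ? ? ? ? ? ? /orP[/orP[]|] /eqP->;
    [apply: le_trans (H0 dx x hdx Ax) _ | apply: le_trans (H1 dx x hdx Ax) _
    | apply: le_trans (H2 dx x hdx Ax) _]; lra.
have /nbhs_ballP[e /= e0 eA] : nbhs xb A by exact: open_nbhs_nbhs.
(* Each of the three populations contributes [2 * C]; the extra 1 makes the constant positive. *)
apply/eqO_exP; exists (6 * C + 1); first by lra.
near=> dx.
have dx_gt0 : 0 < dx by near: dx; exact: nbhs_right_gt.
have dx_lt : dx < dx0 by near: dx; exact: nbhs_right_lt.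
(* The farthest node used is [xb - 2 * dx]. *)
have dx_e : dx < e / 2 by near: dx; apply: nbhs_right_lt; lra.
have hdx : 0 < dx < dx0 by rewrite dx_gt0.
have At t : xb - 2 * dx <= t <= xb -> A t.
  by move=> ht; apply: eA; rewrite /ball /= ger0_norm; lra.
have A1 : A (xb - dx) by apply: At; lra.
have A2 : A (xb - 2 * dx) by apply: At; lra.
have I j := @midpoint_interpolation_le R (fun y => f dx y j 0) xb dx C C0
  (ltW dx_gt0) (fun k t ht => fsm dx j hdx k t (At t ht))
  (fun t ht => fC j dx t hdx (At t ht)).
have := density_interpolation A dx (dp dx) (f dx) Axb A1 A2
  (fsch dx hdx) (fbc dx hdx).
rewrite !densityE (ger0_norm (exprn_ge0 _ (ltW dx_gt0))).
have dx3 : 0 <= dx ^+ 3 by rewrite exprn_ge0 ?ltW.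
(* The constant [dp / 2] is reproduced exactly, as the weights sum to 1; after generalization the
   goal is linear. *)
move: (I 0) (I 1) (I 2); rewrite !ler_norml mulrDl mul1r /=.
move: (f dx (xb - dx / 2)) (f dx xb) (f dx (xb - dx)) (f dx (xb - 2 * dx)).
move: (dp dx) (dx ^+ 3) dx3 => d H H0 u v w z.
move: (u 0 0) (u 1 0) (u 2 0) (v 0 0) (v 1 0) (v 2 0) (w 0 0) (w 1 0) (w 2 0).
move: (z 0 0) (z 1 0) (z 2 0) => *.
lra.
Unshelve. all: by end_near. Qed.

End Sufficiency.

(** * Quadratic polynomials and uniform bounds on their derivatives *)

Section Quadratic.
Variables (R : realType) (xb : R).

Definition quadratic (c0 c1 c2 : R) (x : R) : R :=
  c0 + c1 * (x - xb) + c2 * (x - xb) ^+ 2.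

Lemma is_derive_quadratic (c0 c1 c2 x : R) :
  is_derive x 1 (quadratic c0 c1 c2) (quadratic c1 (2 * c2) 0 x).
Proof.
rewrite /quadratic; apply: is_derive_eq; rewrite /GRing.scale /=.
by ring.
Qed.

Lemma derive1_quadratic (c0 c1 c2 : R) :
  (quadratic c0 c1 c2)^`()%classic = quadratic c1 (2 * c2) 0.
Proof.
apply/funext => x; rewrite derive1E.
exact: (@derive_val _ _ _ _ _ _ _ (is_derive_quadratic c0 c1 c2 x)).
Qed.

(** Differentiation keeps the quadratic form and at most doubles the sum of absolute coefficients,
    which bounds all orders by one induction. *)
Lemma derive1n_quadratic (k : nat) (c0 c1 c2 : R) :
  exists d0 d1 d2, derive1n k (quadratic c0 c1 c2) = quadratic d0 d1 d2 /\
    `|d0| + `|d1| + `|d2| <= 2 ^+ k * (`|c0| + `|c1| + `|c2|).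
Proof.
elim: k => [|k [d0 [d1 [d2 [IH le_d]]]]].
  by exists c0, c1, c2; rewrite expr0 mul1r.
exists d1, (2 * d2), 0; split; first by rewrite derive1nS IH derive1_quadratic.
rewrite exprS -mulrA normr0 normrM ger0_norm//.
have := normr_ge0 d0; have := normr_ge0 d1; lra.
Qed.

Lemma smooth_on_quadratic (A : set R) (c0 c1 c2 : R) :
  smooth_on A (quadratic c0 c1 c2).
Proof.
move=> k x _; have [d0 [d1 [d2 [-> _]]]] := derive1n_quadratic k c0 c1 c2.
exact: (@ex_derive _ _ _ _ _ _ _ (is_derive_quadratic d0 d1 d2 x)).
Qed.

Lemma derive1n_quadratic_le (k : nat) (c0 c1 c2 x : R) : ball xb 1 x ->
  `|derive1n k (quadratic c0 c1 c2) x| <= 2 ^+ k * (`|c0| + `|c1| + `|c2|).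
Proof.
rewrite /ball /= distrC => /ltW x1.
have [d0 [d1 [d2 [-> le_d]]]] := derive1n_quadratic k c0 c1 c2.
apply: le_trans le_d; rewrite /quadratic.
apply: (le_trans (ler_normD _ _)); apply: lerD.
  apply: (le_trans (ler_normD _ _)); rewrite lerD2l normrM.
  by rewrite ler_piMr.
by rewrite normrM ler_piMr// normrX exprn_ile1.
Qed.

End Quadratic.

(** * Necessity, by an exact quadratic solution *)

Section Necessity.
Variables (R : realType) (lambda zeta s1 s2 xb : R).
Hypotheses (lambda_gt0 : 0 < lambda) (zeta_gt : 0 < 2 + zeta).
Hypotheses (s1_bound : 0 < s1 < 2) (s2_gt0 : 0 < s2).

Let s1_neq0 : s1 != 0. Proof. by apply: lt0r_neq0; case/andP: s1_bound. Qed.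
Let s1_neq2 : 2 - s1 != 0.
Proof. by apply: lt0r_neq0; case/andP: s1_bound; rewrite subr_gt0. Qed.
Let lambda_neq0 := lt0r_neq0 lambda_gt0.
Let s2_neq0 := lt0r_neq0 s2_gt0.
Let zeta_neq := lt0r_neq0 zeta_gt.

(* Coefficients [c] of an exact solution with source [dx ^+ 2]: component [j]
   is [c 0 * dx ^+ 2 + c 1 * dx * (x - xb) + c 2 * (x - xb) ^+ 2]. *)
Definition exact_coef (j : 'I_3) : seq R :=
  let b := 2 - s1 in
  nth [::]
  [:: [:: sigma s2 / (2 + zeta); 0; s1 / b * (1 - 3 / (2 + zeta))];
      [:: - (1 / 4); 1 / b; - (s1 / (2 * b))];
      [:: - (1 / 4); - (1 / b); - (s1 / (2 * b))]] j.

Definition exact_solution (dx x : R) : 'cV[R]_3 :=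
  \col_j quadratic R xb ((exact_coef j)`_0 * dx ^+ 2)
    ((exact_coef j)`_1 * dx) ((exact_coef j)`_2) x.

(** For this ansatz, with [f_1 - f_2] linear and [f_1 + f_2] even about [xb], advection with source
    [dx ^+ 2] forces the linear and quadratic coefficients of [f_1] and [f_2]; the rest equation
    then gives [f_0]. *)
Lemma exact_solution_scheme (A : set R) (dx : R) :
  lb_scheme lambda zeta s1 s2 A dx (dx ^+ 2) (steady (exact_solution dx)).
Proof.
have rest x : exact_solution dx x 0 0 =
    f_star lambda zeta s1 s2 (dx ^+ 2) (exact_solution dx x) 0 0.
  rewrite f_star0E// !mxE /quadratic /= /sigma.
  by field; rewrite s1_neq2 zeta_neq s2_neq0.
apply/lb_scheme_steady => //; split=> // x _ _.
  rewrite rest_f_star1// !mxE /quadratic /=.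
  by field.
rewrite rest_f_star2// !mxE /quadratic /=.
by field.
Qed.

(** Advection leaves the constant term of [f_1 + f_2] free; the boundary condition fixes it as
    [- dx ^+ 2 / 2], whence the two entries [- (1 / 4)]. *)
Lemma exact_solution_bc (dx : R) : anti_bounce_back lambda zeta s1 s2 xb dx
  (dx ^+ 2) (steady (exact_solution dx)).
Proof.
move=> t; rewrite /steady rest_f_star2//; last first.
  have /(lb_scheme_steady _ _ _ _ _ _ _ _ lambda_neq0)[+ _ _] :=
    exact_solution_scheme setT dx.
  exact.
by rewrite !mxE /quadratic /=; field.
Qed.

Lemma exact_solution_density (dx : R) :
  density lambda (dx ^+ 2) (exact_solution dx (xb - dx / 2)) =
  (sigma s1 * sigma s2 - 3 / 8) / (sigma s1 * (2 + zeta)) * dx ^+ 2.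
Proof.
have -> : sigma s1 = (2 - s1) / (2 * s1) by rewrite /sigma; field.
rewrite densityE !mxE /quadratic /=.
field.
by rewrite s1_neq2 zeta_neq s1_neq0.
Qed.

(** For [dx <= 1] the powers of [dx] in the coefficients are at most 1, which makes the bounds
    uniform. *)
Lemma slow_exact_solution : slow_steady_family lambda zeta s1 s2 (ball xb 1) 1
  (fun dx => dx ^+ 2) exact_solution.
Proof.
have fE dx j : (fun x => exact_solution dx x j 0) = quadratic R xb
    ((exact_coef j)`_0 * dx ^+ 2) ((exact_coef j)`_1 * dx) ((exact_coef j)`_2).
  by apply/funext => x; rewrite mxE.
split=> [dx j _|k j|dx _]; last exact: exact_solution_scheme.
  by rewrite fE; exact: smooth_on_quadratic.
exists (2 ^+ k * (`|(exact_coef j)`_0| + `|(exact_coef j)`_1|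
                  + `|(exact_coef j)`_2|)).
move=> dx x /andP[/ltW dx0 /ltW dx1] xA; rewrite fE.
apply: le_trans (derive1n_quadratic_le _ _ _ _ _ _ _ xA) _.
rewrite ler_pM2l ?exprn_gt0// lerD2r lerD// normrM ler_piMr//.
  by rewrite normrX exprn_ile1// ger0_norm.
by rewrite ger0_norm.
Qed.

Lemma order3_sigma :
  dirichlet_order lambda zeta s1 s2 xb
    (anti_bounce_back lambda zeta s1 s2 xb) (fun dx : R => dx / 2) 3 ->
  sigma s1 * sigma s2 = 3 / 8.
Proof.
move=> H.
have iA : is_interval (ball xb (1 : R)).
  by rewrite ball_itv; exact: interval_is_interval.
have := H _ _ _ _ (ball_open xb 1) iA (ballxx xb ltr01) ltr01
  slow_exact_solution (fun dx _ => exact_solution_bc dx).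
move=> /eqO_exP[k k0 /= nk].
have s1_gt0 : 0 < sigma s1.
  have -> : sigma s1 = (2 - s1) / (2 * s1) by rewrite /sigma; field.
  by case/andP: s1_bound => ? ?; rewrite divr_gt0 ?mulr_gt0 ?subr_gt0.
set K := (sigma s1 * sigma s2 - 3 / 8) / (sigma s1 * (2 + zeta)).
suff K0 : K = 0.
  apply/eqP; rewrite -subr_eq0; move/eqP: K0; rewrite mulf_eq0 => /orP[//|].
  by rewrite invr_eq0 mulf_eq0 (gt_eqF s1_gt0) (gt_eqF zeta_gt).
apply/eqP/negPn/negP => Kn; have Kp : 0 < `|K| by rewrite normr_gt0.
suff : \forall dx \near ((0 : R)^'+)%classic, False.
  by move=> /filter_ex[].
near=> dx.
have dx_gt0 : 0 < dx by near: dx; exact: nbhs_right_gt.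
(* Below this threshold [k * dx ^+ 3 < |K| * dx ^+ 2], against the assumed third order. *)
have : dx < `|K| / k by near: dx; apply: nbhs_right_lt; rewrite divr_gt0.
have : `|density lambda (dx ^+ 2) (exact_solution dx (xb - dx / 2))|
     <= k * `|dx ^+ 3| by near: dx; exact: nk.
rewrite exact_solution_density -/K normrM !normrX (ger0_norm (ltW dx_gt0)).
rewrite [dx ^+ 3]exprS mulrA ler_pM2r ?exprn_gt0// ltr_pdivlMr// mulrC => h1 h2.
by have := le_lt_trans h1 h2; rewrite ltxx.
Unshelve. all: by end_near. Qed.

End Necessity.

Theorem proposition2 (R : realType) (lambda zeta s1 s2 xb : R) :
  0 < lambda -> 0 < 2 + zeta -> 0 < s1 < 2 -> 0 < s2 < 2 ->
  dirichlet_order lambda zeta s1 s2 xb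
    (anti_bounce_back lambda zeta s1 s2 xb) (fun dx : R => dx / 2) 3
  <-> sigma s1 * sigma s2 = 3 / 8.
Proof.
move=> l0 z0 hs1 /andP[s20 _]; split; first exact: order3_sigma.
exact: anti_bounce_back_order3.
Qed.
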